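(* For any weighted digraph $\Gamma$ with Kirchhoff matrix $L$ and out forest dimension $v$, and any $\tau>0$, $$Q(\tau)=(I+\tau L)^{-1}=s^{-1}(\tau)\sum_{i=0}^{n-v}s_{n-v-i}(\tau)\,(-\tau L)^i,$$ where $s_k(\tau)=\sum_{j=0}^{k}\tau^j\sigma_j$, $k=0,\dots,n-v$, and $s^{-1}(\tau)=1/s(\tau)$ with $s(\tau)=\sum_{j=0}^{n-v}\tau^j\sigma_j$.
   Context: $\Gamma$ is a weighted digraph without loops with vertex set $\{1,\dots,n\}$, $n>1$; all arcs have strictly positive real weights; $\varepsilon_{ij}$ denotes the weight of the arc from $i$ to $j$, with $\varepsilon_{ij}=0$ if and only if there is no such arc. The Kirchhoff matrix $L=(\ell_{ij})$ is the $n\times n$ matrix with $\ell_{ij}=-\varepsilon_{ji}$ for $j\ne i$ and $\ell_{ii}=-\sum_{k\ne i}\ell_{ik}$. For $\tau>0$, $Q(\tau)=(I+\tau L)^{-1}$ (the inverse exists). A diverging forest is a digraph without (directed) circuits in which every vertex has indegree at most 1. An out forest of $\Gamma$ is a spanning subgraph of $\Gamma$ that is a diverging forest. The weight of a subgraph is the product of the weights of its arcs (1 if it has no arcs); the weight of a set of subgraphs is the sum of the weights of its elements (0 for the empty set). The out forest dimension $v$ is the minimum number of weak components of an out forest of $\Gamma$, so the maximum number of arcs of an out forest is $n-v$. $\sigma_k$ is the total weight of the set of all out forests of $\Gamma$ with $k$ arcs. *)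

(* Defs.v *)
From HB Require Import structures.
From mathcomp Require Import all_boot all_order all_algebra.

Set Implicit Arguments.
Unset Strict Implicit.
Unset Printing Implicit Defensive.

Import Order.TTheory GRing.Theory Num.Theory.
Local Open Scope ring_scope.

Record wdigraph (R : realFieldType) (n : nat) := WDigraph {
  arc : rel 'I_n;
  eps : 'I_n -> 'I_n -> R;
  arc_irrefl : irreflexive arc;
  eps_gt0 : forall i j, arc i j -> 0 < eps i j;
  eps_eq0 : forall i j, (eps i j = 0) <-> ~~ arc i j
}.

(* The entry (i, j) involves the arc from j to i. *)
Definition kirchhoff (R : realFieldType) (n : nat) (G : wdigraph R n) : 'M[R]_n :=
  \matrix_(i, j)
    if j != i then - eps G j i else - \sum_(k | k != i) (- eps G k i).

Definition Qmx (R : realFieldType) (n : nat) (G : wdigraph R n) (tau : R) : 'M[R]_n :=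
  invmx (1%:M + tau *: kirchhoff G).

(* A digraph with vertex set 'I_n is identified with its set of arcs (i, j),
   going from i to j; this also encodes the spanning subgraphs of a digraph. *)
Definition arc_rel (n : nat) (F : {set 'I_n * 'I_n}) : rel 'I_n :=
  fun i j => (i, j) \in F.

(* A circuit visits between 1 and n pairwise distinct vertices, hence the
   bound on its length, which makes this predicate boolean; see circuit_freeP. *)
Definition circuit_free (n : nat) (F : {set 'I_n * 'I_n}) : bool :=
  [forall k : 'I_n, [forall c : k.+1.-tuple 'I_n, ~~ ucycleb (arc_rel F) c]].

Definition indegree (n : nat) (F : {set 'I_n * 'I_n}) (j : 'I_n) : nat :=
  #|[set i | (i, j) \in F]|.

Definition diverging_forest (n : nat) (F : {set 'I_n * 'I_n}) : bool :=
  circuit_free F && [forall j, (indegree F j <= 1)%N].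

Definition out_forest (R : realFieldType) (n : nat) (G : wdigraph R n)
    (F : {set 'I_n * 'I_n}) : bool :=
  (F \subset [set a | arc G a.1 a.2]) && diverging_forest F.

Definition weak_components (n : nat) (F : {set 'I_n * 'I_n}) : nat :=
  n_comp (fun i j => arc_rel F i j || arc_rel F j i) 'I_n.

(* The default value set0 is an out forest (out_forest0), so that this is the
   minimum of weak_components over the out forests; see out_forest_dimP. *)
Definition out_forest_dim (R : realFieldType) (n : nat) (G : wdigraph R n) : nat :=
  weak_components [arg min_(F < set0 | out_forest G F) weak_components F].

Definition subgraph_weight (R : realFieldType) (n : nat) (G : wdigraph R n)
    (F : {set 'I_n * 'I_n}) : R :=
  \prod_(a in F) eps G a.1 a.2.

Definition sigma (R : realFieldType) (n : nat) (G : wdigraph R n) (k : nat) : R :=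
  \sum_(F : {set 'I_n * 'I_n} | out_forest G F && (#|F| == k))
     subgraph_weight G F.

Definition s_ (R : realFieldType) (n : nat) (G : wdigraph R n) (k : nat) (tau : R) : R :=
  \sum_(0 <= j < k.+1) tau ^+ j * sigma G j.

Definition s_total (R : realFieldType) (n : nat) (G : wdigraph R n) (tau : R) : R :=
  \sum_(0 <= j < (n - out_forest_dim G).+1) tau ^+ j * sigma G j.

Lemma circuit_freeP (n : nat) (F : {set 'I_n * 'I_n}) :
  reflect (forall c : seq 'I_n, cycle (arc_rel F) c -> uniq c -> c = [::])
          (circuit_free F).
Proof.
apply: (iffP forallP) => [H [//|x c] Hc Hu | H k].
  have Hk : (size c < n)%N.
    by have := max_card [in x :: c]; rewrite (card_uniqP Hu) card_ord.
  have /forallP/(_ (in_tuple (x :: c))) := H (Ordinal Hk).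
  by rewrite /ucycleb /= in Hc Hu *; rewrite Hc Hu.
apply/forallP => c; apply/negP => /andP[Hc Hu].
by have /(congr1 size) := H _ Hc Hu; rewrite size_tuple.
Qed.

Lemma out_forest0 (R : realFieldType) (n : nat) (G : wdigraph R n) :
  out_forest G set0.
Proof.
rewrite /out_forest sub0set /=; apply/andP; split.
  apply/circuit_freeP => -[//|x [|y c]]; first by rewrite /= /arc_rel inE.
  by rewrite /= {1}/arc_rel inE.
apply/forallP => j; rewrite /indegree.
by rewrite (_ : [set i | _] = set0) ?cards0 //; apply/setP => i; rewrite !inE.
Qed.

Lemma out_forest_dimP (R : realFieldType) (n : nat) (G : wdigraph R n) :
  (exists2 F, out_forest G F & weak_components F = out_forest_dim G) /\
  (forall F, out_forest G F -> (out_forest_dim G <= weak_components F)%N).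
Proof.
by rewrite /out_forest_dim; case: arg_minnP => [|F HF Hm];
  [exact: out_forest0 | split=> //; exists F].
Qed.

(* Main.v *)
(** The characteristic polynomial of -L is sum_j sigma_j X^(n-j) (all-forests
    matrix-tree theorem), and sigma_j = 0 for j > m := n - v.  Cayley-Hamilton
    then gives L^v (sum_(j <= m) sigma_j (-L)^(m-j)) = 0.  Since 1 + t L does
    not decrease the maximum norm for any t > 0, ker L^2 = ker L, so that the
    power L^v may be replaced with L.  Multiplying the claimed expression for
    Q(tau) by 1 + tau L telescopes to s(tau) minus tau^(m+1) times
    sum_(j <= m) sigma_j (-L)^(m+1-j), which vanishes. *)
Require Import Defs.
From HB Require Import structures.
From mathcomp Require Import all_boot all_order all_algebra.
From mathcomp Require Import fingroup perm.

Set Implicit Arguments.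
Unset Strict Implicit.
Unset Printing Implicit Defensive.

Import Order.TTheory GRing.Theory Num.Theory.
Local Open Scope ring_scope.

(** * Forests as parent functions *)

(** Choosing at most one parent for every vertex encodes the digraphs of indegree at most 1, and
    such choices index the expansion of the determinant. *)
Definition parent_arcs (n : nat) (f : 'I_n -> option 'I_n) : {set 'I_n * 'I_n} :=
  [set a | f a.2 == Some a.1].

Definition parent (n : nat) (F : {set 'I_n * 'I_n}) : {ffun 'I_n -> option 'I_n} :=
  [ffun j => [pick i | (i, j) \in F]].

Lemma parent_arcsK (n : nat) (f : {ffun 'I_n -> option 'I_n}) :
  parent (parent_arcs f) = f.
Proof.
apply/ffunP => j; rewrite ffunE; case: pickP => [i|H].
  by rewrite inE /= => /eqP.
by case E: (f j) => [i|] //; have := H i; rewrite inE /= E eqxx.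
Qed.

Lemma indegree_parent_arcs (n : nat) (f : 'I_n -> option 'I_n) j :
  (indegree (parent_arcs f) j <= 1)%N.
Proof.
apply/card_le1P => i; rewrite !inE /= => /eqP fj k.
by rewrite !inE /= fj; apply/eqP/eqP => [[->]|->].
Qed.

Lemma parent_arcs_snd_inj (n : nat) (f : 'I_n -> option 'I_n) :
  {in parent_arcs f &, injective snd}.
Proof.
by move=> [a b] [a' b']; rewrite !inE /= => /eqP + /eqP + bb; rewrite bb => -> [->].
Qed.

Lemma parentK (n : nat) (F : {set 'I_n * 'I_n}) :
  (forall j, indegree F j <= 1)%N -> parent_arcs (parent F) = F.
Proof.
move=> dF; apply/setP => -[i j]; rewrite inE /= ffunE.
case: pickP => [k Fkj|->] //; apply/eqP/idP => [[<-] //|Fij].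
have /card_le1P/(_ k) := dF j; rewrite inE => /(_ Fkj i).
by rewrite !inE Fij => /esym/eqP ->.
Qed.

(** * Determinants detecting circuits *)

Definition parent_mx (K : pzRingType) (n : nat) (f : 'I_n -> option 'I_n) : 'M[K]_n :=
  \matrix_(i, j) ((i == j)%:R - (f i == Some j)%:R).

(** Row [i] is the unit vector of [i] minus that of its parent, so the rows along a circuit sum to
    zero. *)
Lemma det_parent_mx_circuit (K : idomainType) (n : nat) (f : 'I_n -> option 'I_n) :
  ~~ circuit_free (parent_arcs f) -> \det (parent_mx K f) = 0.
Proof.
apply: contraNeq => det_n0.
apply/circuit_freeP => c cyc uc; case: (posnP (size c)) => [/size0nil //|c_gt0].
case/negP: det_n0; apply/det0P; exists (\row_i (i \in c)%:R).
  case: c c_gt0 {cyc uc} => // x c _; apply/eqP => /rowP/(_ x)/eqP.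
  by rewrite !mxE mem_head oner_eq0.
apply/rowP => j; rewrite !mxE.
(* On the circuit the parent of [i] is its predecessor, so [f i = Some j] means [i = next c j]. *)
transitivity (\sum_(i in c) ((i == j)%:R - (i == next c j)%:R : K)).
  rewrite [RHS]big_mkcond /=; apply: eq_bigr => i _; rewrite !mxE.
  case: ifP => ci; last by rewrite mul0r.
  rewrite mul1r; congr (_ - _%:R); have := prev_cycle cyc ci.
  rewrite /arc_rel inE /= => /eqP ->; congr nat_of_bool; apply/eqP/eqP => [[<-]|->].
    by rewrite next_prev.
  by rewrite prev_next.
have S k : \sum_(i in c) ((i == k)%:R : K) = (k \in c)%:R.
  case ck: (k \in c); last first.
    by rewrite big1 // => i ci; case: eqP => // ik; rewrite -ik ci in ck.
  rewrite (bigD1 k) //= eqxx big1 ?addr0 // => i /andP[_ /negbTE ->] //.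
by rewrite sumrB !S mem_next subrr.
Qed.

(* A permutation s <> 1 contributing to the determinant satisfies
   f i = Some (s i) wherever s i != i, so its orbits are circuits. *)
Lemma det_parent_mx_forest (K : comNzRingType) (n : nat) (f : 'I_n -> option 'I_n) :
  circuit_free (parent_arcs f) -> \det (parent_mx K f) = 1.
Proof.
move=> /circuit_freeP cf; rewrite /determinant (bigD1 (1%g : {perm 'I_n})) //=.
rewrite [X in _ + X]big1.
  rewrite addr0 odd_perm1 expr0 mul1r big1 // => i _.
  rewrite mxE perm1 eqxx; case: eqP => [fi|_]; last by rewrite subr0.
  by have := cf [:: i]; rewrite /= /arc_rel inE /= fi eqxx => /(_ isT isT).
move=> s s_n1; case: (boolP [forall i, (s i == i) || (f i == Some (s i))]); last first.
  rewrite negb_forall => /existsP[i]; rewrite negb_or => /andP[/negbTE si /negbTE fi].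
  by rewrite (bigD1 i) //= mxE fi eq_sym si subrr mul0r mulr0.
move=> /forallP H; have [i si] : exists i, s i != i.
  apply/existsP; apply: contraNT s_n1; rewrite negb_exists => /forallP E.
  by apply/eqP/permP => i; rewrite perm1; have := E i; rewrite negbK => /eqP.
(* Where [s] moves [i], the arc runs from the parent [s i] to [i], so circuits follow the inverse of
   [s]. *)
have injV : injective (s^-1)%g by exact: perm_inj.
suff: orbit (s^-1)%g i = [::].
  by have := in_orbit (s^-1)%g i; move=> /[swap] ->.
apply: cf (orbit_uniq _ _).
have := cycle_orbit injV i; apply: (@sub_in_cycle _ [pred x | s x != x]).
  move=> x y /= _; rewrite inE => sy /eqP xy; rewrite /arc_rel inE /=.
  have := H y; rewrite (negbTE sy) /= => /eqP ->.
  by rewrite -xy permKV.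
apply/allP => x; rewrite -fconnect_orbit => /iter_findex <- /=.
elim: (findex _ _ _) => //= m IH; rewrite permKV.
by apply: contraNneq IH => E; rewrite {1}E permKV.
Qed.

(** * The all-forests matrix-tree theorem *)

(** The ring is arbitrary because the weights will also be polynomials. *)
Definition laplacian (K : pzRingType) (n : nat) (w : 'I_n -> 'I_n -> K) : 'M[K]_n :=
  \matrix_(i, j) if j != i then - w j i else - \sum_(k | k != i) (- w k i).

Lemma sum_option (K : nmodType) (T : finType) (F : option T -> K) :
  \sum_o F o = F None + \sum_k F (Some k).
Proof.
rewrite (bigD1 None) //=; congr (_ + _).
rewrite (reindex_omap (@Some T) id) /=; last by case.
by apply: eq_bigl => k; rewrite eqxx.
Qed.

(** Prepares the multilinear expansion: row [i] is split over the choices of a parent of [i], and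
    choosing none has weight [x]. *)
Lemma scalar_laplacian_row (K : comNzRingType) (n : nat) (x : K)
    (w : 'I_n -> 'I_n -> K) i j :
  (x%:M + laplacian w) i j =
  \sum_(o : option 'I_n) (if o is Some k then w k i else x) *
                         ((i == j)%:R - (o == Some j)%:R).
Proof.
rewrite sum_option subr0 !mxE mulr_natr; congr (_ + _).
transitivity (\sum_k w k i * (i == j)%:R - \sum_k w k i * (k == j)%:R); last first.
  by rewrite -sumrB; apply: eq_bigr => k _; rewrite mulrBr.
rewrite -mulr_suml [X in _ - X](bigD1 j) //= eqxx mulr1.
rewrite [X in _ - (_ + X)]big1 => [|k /negbTE ->].
  rewrite addr0 [j == i]eq_sym; case: eqP => [<-|_] /=; last by rewrite mulr0 sub0r.
  (* The loop weight [w i i] in the full sum cancels here. *)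
  by rewrite mulr1 sumrN opprK [in RHS](bigD1 i) //= addrAC subrr add0r.
by rewrite mulr0.
Qed.

(* The all-forests form of the matrix-tree theorem: by multilinearity in the
   rows, the determinant is a sum over all the choices of at most one parent
   for every vertex. *)
Lemma det_scalar_laplacian (K : idomainType) (n : nat) (x : K)
    (w : 'I_n -> 'I_n -> K) :
  \det (x%:M + laplacian w) =
  \sum_(F | diverging_forest F) x ^+ (n - #|F|) * \prod_(a in F) w a.1 a.2.
Proof.
pose wt (f : {ffun 'I_n -> option 'I_n}) :=
  \prod_i (if f i is Some k then w k i else x).
transitivity (\sum_(f : {ffun 'I_n -> option 'I_n}) wt f * \det (parent_mx K f)).
  rewrite /determinant.
  under eq_bigr => s _ do (under eq_bigr => i _ do rewrite scalar_laplacian_row;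
    rewrite bigA_distr_bigA mulr_sumr).
  rewrite exchange_big /=; apply: eq_bigr => f _; rewrite mulr_sumr.
  apply: eq_bigr => s _; rewrite big_split /= mulrCA; congr (_ * (_ * _)).
  by apply: eq_bigr => i _; rewrite mxE.
rewrite (bigID (fun f : {ffun _} => circuit_free (parent_arcs f))) /=.
rewrite [X in _ + X]big1 ?addr0; last first.
  by move=> f /(det_parent_mx_circuit K) ->; rewrite mulr0.
rewrite [RHS](reindex_onto (fun f : {ffun 'I_n -> option 'I_n} => parent_arcs f)
   (@parent n)) /=; last by move=> F /andP[_ /forallP /parentK].
apply: eq_big => [f|f cf].
  rewrite parent_arcsK eqxx andbT /diverging_forest; case: circuit_free => //=.
  by apply/esym/forallP => j; exact: indegree_parent_arcs.
(* Parentless vertices give the power of [x]; the others correspond to the arcs of which they are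
   the heads. *)
rewrite det_parent_mx_forest // mulr1 /wt (bigID (fun i => f i == None)) /=.
have sndE : snd @: parent_arcs f = [set i | f i != None].
  apply/setP => i; apply/imsetP/idP => [[[a b]]|].
    by rewrite !inE /= => /eqP E ->; rewrite E.
  by rewrite inE; case E: (f i) => [k|] // _; exists (k, i); rewrite ?inE /= ?E.
congr (_ * _).
  under eq_bigr => i /eqP -> do [].
  rewrite prodr_const -(card_in_imset (@parent_arcs_snd_inj _ f)) sndE -cardsE -[n in (n - _)%N]card_ord.
  rewrite -(cardC [set i | f i == None]) addnC.
  rewrite -[X in (X + _)%N](eq_card (A := [set i | f i != None])) ?addKn //.
  by move=> i; rewrite !inE.
rewrite (eq_bigl (fun i => i \in snd @: parent_arcs f)) => [|i]; last by rewrite sndE inE.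
rewrite (big_imset _ (@parent_arcs_snd_inj _ f)); apply: eq_bigr => -[a b]; rewrite inE /= => /eqP -> //.
Qed.

(** * Arcs and weak components of a forest *)

Definition weak_adj (n : nat) (F : {set 'I_n * 'I_n}) : rel 'I_n :=
  fun i j => arc_rel F i j || arc_rel F j i.

Lemma weak_connect_sym (n : nat) (F : {set 'I_n * 'I_n}) : connect_sym (weak_adj F).
Proof. by apply: sym_connect_sym => i j; rewrite /weak_adj orbC. Qed.

(* If no vertex of the component of x were a root, the indicator of this
   component would lie in the kernel of the unimodular matrix parent_mx. *)
Lemma connect_forest_root (n : nat) (f : 'I_n -> option 'I_n) (x : 'I_n) :
  circuit_free (parent_arcs f) ->
  exists2 r, f r = None & connect (weak_adj (parent_arcs f)) x r.
Proof.
move=> cf; set e := weak_adj _; have symC : connect_sym e := @weak_connect_sym _ _.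
have [/existsP[r /andP[/eqP fr xr]]|] := boolP [exists r, (f r == None) && connect e x r].
  by exists r.
rewrite negb_exists => /forallP noroot.
pose u : 'cV[rat]_n := \col_i (connect e x i)%:R.
have Mu0 : parent_mx rat f *m u = 0.
  apply/colP => i; rewrite !mxE.
  under eq_bigr => j _ do rewrite !mxE mulrBl.
  rewrite sumrB (bigD1 i) //= eqxx mul1r big1 => [|j /negbTE]; last first.
    by rewrite eq_sym => ->; rewrite mul0r.
  rewrite addr0; case E: (f i) => [k|]; last first.
    rewrite big1 => [|j _]; last by rewrite mul0r.
    by have := noroot i; rewrite E eqxx /= => /negbTE ->; rewrite subr0.
  rewrite (bigD1 k) //= eqxx mul1r big1 => [|j /negbTE]; last first.
    by move=> jk; rewrite (_ : (Some k == Some j) = (k == j)) // eq_sym jk mul0r.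
  have eik : connect e i k.
    by apply: connect1; rewrite /e /weak_adj /arc_rel !inE /= E eqxx orbT.
  by rewrite addr0 !(symC x) (same_connect symC eik) subrr.
have Mu : parent_mx rat f \in unitmx by rewrite unitmxE det_parent_mx_forest ?unitr1.
have /colP/(_ x)/eqP : u = 0 by rewrite -(mulKmx Mu u) Mu0 mulmx0.
by rewrite !mxE connect0 oner_eq0.
Qed.

(** Distinct arcs have distinct heads, and every weak component contains a vertex that is not a
    head. *)
Lemma diverging_forest_arcs (n : nat) (F : {set 'I_n * 'I_n}) :
  diverging_forest F -> (#|F| + weak_components F <= n)%N.
Proof.
move=> /andP[cf /forallP dF]; have FE := parentK dF.
move: cf; rewrite -FE; set f := parent F => cf.
rewrite /weak_components -/(weak_adj _); set e := weak_adj _.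
have symC : connect_sym e := @weak_connect_sym _ _.
rewrite -(card_in_imset (@parent_arcs_snd_inj _ f)) -[leqRHS]card_ord.
rewrite -(cardC [in snd @: parent_arcs f]) leq_add2l.
(* Here [fingraph.root] picks the representative of a component; each representative is the image of
   some parentless vertex. *)
apply: leq_trans (leq_image_card (fingraph.root e) _); apply: subset_leq_card.
apply/subsetP => x /andP[/eqP rx _]; have [r fr xr] := connect_forest_root x cf.
apply/imageP; exists r; last by rewrite -[LHS]rx; apply/eqP; rewrite (root_connect symC).
by apply/imsetP => -[[a b]]; rewrite !inE /= => + rb; rewrite -rb fr.
Qed.

(** * Maximum norm estimates *)

Section NonnegativeLaplacian.

Variables (R : realFieldType) (n : nat) (w : 'I_n -> 'I_n -> R).
Hypothesis w_ge0 : forall i j, 0 <= w i j.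

Lemma laplacian_mul_col (x : 'cV[R]_n) i :
  (laplacian w *m x) i 0 = \sum_(k | k != i) w k i * (x i 0 - x k 0).
Proof.
rewrite mxE (bigD1 i) //= mxE eqxx /= sumrN opprK mulr_suml -big_split /=.
by apply: eq_bigr => k ki; rewrite mxE ki mulrBr mulNr.
Qed.

(** A maximum principle: in the row of an entry of largest modulus, the diagonal of [laplacian w]
    dominates the off-diagonal part. *)
Lemma id_add_laplacian_expand (x : 'cV[R]_n) (c : R) :
  (forall i, `|((1%:M + laplacian w) *m x) i 0| <= c) -> forall i, `|x i 0| <= c.
Proof.
move=> bound i0.
have [i _ i_max] : exists2 i, true & forall j, `|x j 0| <= `|x i 0|.
  by case: (arg_maxP (fun i => `|x i 0|) (isT : xpredT i0)) => i _ H;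
    exists i => // j; exact: H.
apply: le_trans (i_max i0) _; apply: le_trans (bound i).
rewrite mulmxDl mul1mx mxE laplacian_mul_col.
under eq_bigr do rewrite mulrBr.
rewrite sumrB -mulr_suml; set W := \sum_(k | _) w k i; set S := \sum_(k | _) _.
have W_ge0 : 0 <= W by exact: sumr_ge0.
have S_le : `|S| <= W * `|x i 0|.
  rewrite mulr_suml; apply: le_trans (ler_norm_sum _ _ _) _.
  by apply: ler_sum => k _; rewrite normrM ger0_norm // ler_wpM2l.
(* Since [|S|] is at most [W] times the modulus of [x i 0], the contribution of the diagonal entry
   [W] cancels from both sides. *)
have : `|x i 0 + W * x i 0| <= `|x i 0 + (W * x i 0 - S)| + `|S|.
  by apply: le_trans (ler_normD _ _); rewrite addrA subrK.
have -> : x i 0 + W * x i 0 = (1 + W) * x i 0 by rewrite mulrDl mul1r.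
rewrite normrM (ger0_norm (addr_ge0 ler01 W_ge0)) mulrDl mul1r => H.
rewrite -(lerD2r (W * `|x i 0|)).
by apply: le_trans H _; rewrite lerD2l.
Qed.

(** With [c = 0] the norm estimate says that the kernel is trivial; the transpose appears because
    [det0P] yields row vectors. *)
Lemma id_add_laplacian_unit : 1%:M + laplacian w \in unitmx.
Proof.
rewrite unitmxE unitfE -det_tr; apply/negP => /det0P[v v_n0 v0].
case/eqP: v_n0; apply/rowP => j; rewrite [RHS]mxE; apply/eqP; rewrite -normr_le0.
have := @id_add_laplacian_expand v^T 0; rewrite -[_ *m v^T]trmxK trmx_mul trmxK v0.
by move=> /(_ _ j); rewrite !mxE; apply=> i; rewrite !mxE normr0.
Qed.

End NonnegativeLaplacian.

Lemma scale_laplacian (R : realFieldType) (n : nat) (w : 'I_n -> 'I_n -> R) t :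
  t *: laplacian w = laplacian (fun i j => t * w i j).
Proof.
apply/matrixP => i j; rewrite !mxE; case: ifP => _; first by rewrite mulrN.
by rewrite !sumrN !opprK mulr_sumr.
Qed.

(* If L (L u) = 0 then (1 + t L) (u - t L u) = u, so u - t L u stays bounded
   as t goes to infinity. *)
Lemma ker_laplacian_sqr (R : realFieldType) (n : nat) (w : 'I_n -> 'I_n -> R)
    (u : 'cV[R]_n) :
  (forall i j, 0 <= w i j) ->
  laplacian w *m (laplacian w *m u) = 0 -> laplacian w *m u = 0.
Proof.
move=> w_ge0 LLu0; set y := laplacian w *m u in LLu0 *.
pose c := \sum_i `|u i 0|.
have u_le i : `|u i 0| <= c by rewrite /c (bigD1 i) //= lerDl sumr_ge0.
have bound t i : 0 < t -> `|(u - t *: y) i 0| <= c.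
  move=> t_gt0; apply: (@id_add_laplacian_expand _ _ (fun i j => t * w i j)) => [j k|j].
    by rewrite mulr_ge0 // ltW.
  rewrite -scale_laplacian mulmxDl mul1mx mulmxBr -!scalemxAl -scalemxAr -/y LLu0.
  by rewrite !scaler0 subr0 subrK.
clearbody y; apply/colP => i; rewrite [RHS]mxE; apply/eqP; apply: contraT => y_n0.
have c_ge0 : 0 <= c by rewrite sumr_ge0.
have y_gt0 : 0 < `|y i 0| by rewrite normr_gt0.
(* This [t] makes the modulus of [t * y i 0] equal to [c + c + 1], while the bounds on [u] and
   [u - t *: y] only allow [c + c]. *)
have t_gt0 : 0 < (c + c + 1) / `|y i 0| by rewrite divr_gt0 // ltr_wpDl ?addr_ge0.
have := bound _ i t_gt0; set t := _ / _ in t_gt0 *; rewrite !mxE => H.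
suff : c + c + 1 <= c + c by rewrite gerDl ler10.
have -> : c + c + 1 = `|t * y i 0|.
  by rewrite normrM (gtr0_norm t_gt0) /t divfK ?gt_eqF.
rewrite -[t * _](subKr (u i 0)); apply: le_trans (ler_normB _ _) _.
exact: lerD (u_le i) H.
Qed.

(** * Forest weights and the characteristic polynomial *)

Section OutForests.

Variables (R : realFieldType) (n : nat) (G : wdigraph R n).

Lemma eps_ge0 i j : 0 <= eps G i j.
Proof.
case: (boolP (Defs.arc G i j)) => [/eps_gt0/ltW //|/eps_eq0 ->]; exact: lexx.
Qed.

Lemma kirchhoffE : kirchhoff G = laplacian (eps G).
Proof. by []. Qed.

Lemma out_forest_arcs F : out_forest G F -> (#|F| <= n - out_forest_dim G)%N.
Proof.
move=> oF; have [_ /(_ F oF) dim_le] := out_forest_dimP G.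
have /andP[_ /diverging_forest_arcs le_n] := oF.
rewrite leq_subRL; first by apply: leq_trans le_n; rewrite addnC leq_add2l.
by apply: leq_trans dim_le _; apply: leq_trans le_n; rewrite leq_addl.
Qed.

Lemma sigma_ge0 k : 0 <= sigma G k.
Proof. by apply: sumr_ge0 => F _; apply: prodr_ge0 => a _; exact: eps_ge0. Qed.

(** The empty forest has weight 1; this keeps [s_total] away from zero. *)
Lemma sigma0_ge1 : 1 <= sigma G 0.
Proof.
rewrite /sigma (bigD1 set0) ?out_forest0 ?cards0 //= /subgraph_weight big_set0 lerDl.
by apply: sumr_ge0 => F _; apply: prodr_ge0 => a _; exact: eps_ge0.
Qed.

Lemma s_total_gt0 tau : 0 < tau -> 0 < s_total G tau.
Proof.
move=> tau_gt0; rewrite /s_total big_nat_recl // expr0 mul1r ltr_wpDr //.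
  by apply: sumr_ge0 => j _; rewrite mulr_ge0 ?sigma_ge0 // exprn_ge0 // ltW.
exact: lt_le_trans ltr01 sigma0_ge1.
Qed.

Lemma char_poly_opp_kirchhoff :
  char_poly (- kirchhoff G) =
  \sum_(j < (n - out_forest_dim G).+1) sigma G j *: 'X^(n - j).
Proof.
rewrite /char_poly /char_poly_mx.
have -> : 'X%:M - map_mx polyC (- kirchhoff G) =
          'X%:M + laplacian (fun i j => (eps G i j)%:P).
  congr (_ + _); apply/matrixP => i j; rewrite !mxE polyCN opprK.
  case: ifP => _; first by rewrite polyCN.
  by rewrite !sumrN !opprK rmorph_sum.
rewrite det_scalar_laplacian.
(* A forest using a pair that is not an arc has weight zero, which leaves the out forests of [G]. *)
rewrite (bigID (fun F : {set 'I_n * 'I_n} => F \subset [set a | Defs.arc G a.1 a.2])) /=.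
rewrite [X in _ + X]big1 => [|F /andP[_ /subsetPn[a Fa]]]; last first.
  rewrite inE => /eps_eq0 a0.
  by rewrite (bigD1 a) //= a0 polyC0 mul0r mulr0.
rewrite addr0 (eq_bigl (out_forest G)) => [|F]; last by rewrite andbC.
(* Group by the number of arcs; [out_forest_arcs] ensures that [inord] never falls back on its
   default value. *)
rewrite (partition_big (fun F : {set 'I_n * 'I_n} =>
  inord #|F| : 'I_(n - out_forest_dim G).+1) xpredT) //=.
apply: eq_bigr => j _; rewrite scaler_suml; apply: eq_big => [F|F /andP[oF /eqP <-]].
  case oF: (out_forest G F) => //=.
  by rewrite -val_eqE /= inordK // ltnS out_forest_arcs.
by rewrite inordK ?ltnS ?out_forest_arcs // -rmorph_prod /= mulrC mul_polyC.
Qed.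

End OutForests.

(** * Annihilating polynomial and telescoping *)

(** The equality of ker L^2 and ker L, applied column by column, removes one factor at a time. *)
Lemma ker_laplacian_exp (R : realFieldType) (n : nat) (w : 'I_n.+1 -> 'I_n.+1 -> R)
    (U : 'M[R]_n.+1) k :
  (forall i j, 0 <= w i j) -> laplacian w ^+ k * U = 0 -> laplacian w * U = 0.
Proof.
move=> w_ge0; elim: k U => [|k IH] U; first by rewrite mul1r => ->; rewrite mulr0.
rewrite exprSr -mulrA => /IH LLU0; apply/matrixP => i j.
suff /colP/(_ i) : laplacian w *m col j U = 0 by rewrite colE mulmxA -colE !mxE.
apply: ker_laplacian_sqr w_ge0 _; rewrite colE (mulmxA _ U) mulmxA.
by rewrite (_ : _ *m (_ *m U) = 0) ?mul0mx.
Qed.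

Lemma kirchhoff_annihilator (R : realFieldType) (n : nat) (G : wdigraph R n.+1) :
  let m := (n.+1 - out_forest_dim G)%N in
  \sum_(0 <= j < m.+1) sigma G j *: (- kirchhoff G) ^+ (m.+1 - j) = 0.
Proof.
move=> m; set N := - kirchhoff G.
have m_le : (m <= n.+1)%N by exact: leq_subr.
pose U := \sum_(j < m.+1) sigma G j *: N ^+ (m - j).
(* The exponents in Cayley-Hamilton are [n.+1 - j = (n.+1 - m) + (m - j)], so the power [n.+1 - m]
   of [N] factors out. *)
have NU : N ^+ (n.+1 - m) * U = 0.
  have := Cayley_Hamilton N; rewrite char_poly_opp_kirchhoff linear_sum /= => <-.
  rewrite mulr_sumr; apply: eq_bigr => j _.
  rewrite linearZ /= rmorphXn /= horner_mx_X -scalerAr -exprD.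
  by rewrite addnBA ?subnK // -ltnS.
have {NU} LU0 : kirchhoff G * U = 0.
  apply: ker_laplacian_exp (n.+1 - m)%N (@eps_ge0 _ _ G) _.
  have := congr1 ( *%R ((-1) ^+ (n.+1 - m))) NU.
  by rewrite [N ^+ _]exprNn !mulrA -expr2 sqrr_sign mul1r mulr0.
transitivity (N * U); last by rewrite mulNr LU0 oppr0.
rewrite mulr_sumr big_mkord; apply: eq_bigr => j _.
by rewrite -scalerAr -exprS subSn // -ltnS.
Qed.

(** The coefficients of consecutive powers of [N] differ by a single [c j], so the product
    telescopes. *)
Lemma partial_sums_geometric (R : nzRingType) (A : lalgType R) (m : nat) (N : A)
    (c : nat -> R) :
  (\sum_(0 <= i < m.+1) (\sum_(0 <= j < (m - i).+1) c j) *: N ^+ i) * (1 - N) =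
  (\sum_(0 <= j < m.+1) c j)%:A - \sum_(0 <= j < m.+1) c j *: N ^+ (m.+1 - j).
Proof.
elim: m => [|m IH].
  by rewrite !big_nat1 /= subn0 expr0 expr1 -scalerAl mul1r scalerBr.
(* Without its term [i = 0], the sum is the one for [m] times [N], and [N] commutes with [1 - N]. *)
rewrite big_nat_recl // subn0 expr0.
under eq_bigr => i _ do rewrite subSS exprSr scalerAl.
rewrite -mulr_suml mulrDl -mulrA (commrB (commr1 N) (commr_refl N)) mulrA IH.
rewrite (big_nat_recr m.+1 0 c) //= [X in _ = _ - X]big_nat_recr //=.
have -> : \sum_(0 <= j < m.+1) c j *: N ^+ (m.+2 - j) =
          (\sum_(0 <= j < m.+1) c j *: N ^+ (m.+1 - j)) * N.
  rewrite mulr_suml; apply: eq_big_nat => j /andP[_ j_lt].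
  by rewrite -scalerAl -exprSr subSn // ltnW.
rewrite subSnn expr1.
set s := \sum_(0 <= j < m.+1) c j; rewrite -scalerAl mul1r scalerBr mulrBl -scalerAl mul1r.
rewrite [(_ + _) *: N]scalerDl.
by rewrite [s *: N + _]addrC opprD !addrA subrK addrAC opprD addrA.
Qed.

Theorem mainTheorem4 (R : realFieldType) (n : nat) (n_gt1 : (1 < n)%N)
    (G : wdigraph R n) (tau : R) (tau_gt0 : 0 < tau) :
  let v := out_forest_dim G in
  1%:M + tau *: kirchhoff G \in unitmx /\
  Qmx G tau =
    (s_total G tau)^-1 *:
      \sum_(0 <= i < (n - v).+1)
         s_ G (n - v - i) tau *: (- (tau *: kirchhoff G)) ^+ i.
Proof.
case: n n_gt1 G => // n _ G v.
have A_unit : 1%:M + tau *: kirchhoff G \in unitmx.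
  rewrite kirchhoffE scale_laplacian; apply: id_add_laplacian_unit => i j.
  by rewrite mulr_ge0 ?eps_ge0 // ltW.
split=> //; set P := \sum_(0 <= i < _) _; set m := (n.+1 - v)%N in P *.
have PA : P *m (1%:M + tau *: kirchhoff G) = (s_total G tau)%:M.
  rewrite -[tau *: _]opprK -[RHS]scalemx1.
  (* For this choice of [c], the inner partial sums are the [s_k(tau)]. *)
  apply: etrans (partial_sums_geometric m (- (tau *: kirchhoff G))
                   (fun j => tau ^+ j * sigma G j)) _.
  apply/eqP; rewrite subr_eq addrC -subr_eq subrr; apply/eqP.
  (* Each [tau ^+ j] meets [tau ^+ (m.+1 - j)], so the remainder is [tau ^+ m.+1] times the
     vanishing sum. *)
  transitivity (tau ^+ m.+1 *:
      \sum_(0 <= j < m.+1) sigma G j *: (- kirchhoff G) ^+ (m.+1 - j)).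
    by rewrite kirchhoff_annihilator scaler0.
  rewrite scaler_sumr; apply: eq_big_nat => j /andP[_ j_lt].
  rewrite -scalerN exprZn !scalerA -{1}(subnK (ltnW j_lt)) exprD.
  by congr (_ *: _); rewrite -mulrA mulrC.
have s_n0 : s_total G tau != 0 by rewrite gt_eqF ?s_total_gt0.
by rewrite -[in RHS](mulmxK A_unit P) PA mul_scalar_mx scalerA mulVf // scale1r.
Qed.
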